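(* Let $p$ be a prime and let $M$ be a finite Abelian $p$-group of $p$-rank $d$, generated by $C=\{c_1,\dots,c_q\}$ with $\operatorname{ord}(c_1)\ge\cdots\ge\operatorname{ord}(c_q)$. Let $p^{r_1}=\operatorname{ord}(c_1)$ and, for $t\ge 2$, let $r_t=\min\{k\ge 0 \mid p^k c_t\in\langle c_1,\dots,c_{t-1}\rangle\}$. Suppose that $a_{tj}$ are integers with $0\le a_{tj}\le \operatorname{ord}(c_j)$ such that the following relations hold in $M$: $$p^{r_1}c_1=0,\qquad p^{r_t}c_t=p^{r_t}\sum_{j<t}a_{tj}c_j\ \ (2\le t\le d),\qquad c_t=\sum_{j\le d}a_{tj}c_j\ \ (d<t\le q).$$ Put $b_1=c_1$ and $b_t=c_t-\sum_{j=1}^{t-1}a_{tj}c_j$ for $2\le t\le d$. Then the set $$\overline{C}=\{b_1,\dots,b_d\}=\Big\{c_1,\ c_2-a_{21}c_1,\ \dots,\ c_d-\sum_{t=1}^{d-1}a_{dt}c_t\Big\}$$ is a $p$-basis of $M$.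
   Context: The group $M$ is written additively and $\operatorname{ord}(m)$ denotes the order of $m\in M$. The $p$-rank of $M$ is the minimal number of generators of $M$, i.e. $\dim_{\mathbb{F}_p}(M/pM)$. A set $B=\{b_1,\dots,b_d\}\subset M$ is a $p$-basis of $M$ if $M$ is the (internal) direct sum $\langle b_1\rangle\oplus\cdots\oplus\langle b_d\rangle$. *)

(* Defs.v *)
From mathcomp Require Import all_boot all_order all_algebra all_fingroup all_solvable.

Set Implicit Arguments.
Unset Strict Implicit.
Unset Printing Implicit Defensive.

(* The finGroupType structure of a finZmodType M is that of (M, +), so <[x]> is
   a cyclic subgroup of (M, +) and dprod is the internal direct sum. When d is
   the p-rank of M, every summand is non-trivial, so the b i are pairwise
   distinct and the family is the same data as the set of its values. *)
Definition p_basis (M : finZmodType) (d : nat) (b : 'I_d -> M) : Prop :=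
  (\big[dprod/1]_(i < d) <[b i]>)%g = [set: M].

(* Main.v *)
(* The chain G_t = <c_0, ..., c_(t-1)> is also generated by b_0, ..., b_(t-1),
   the change of generators being unitriangular.  By minimality of r_t the image
   of b_t in M / G_t has order p^(r_t), while the relation p^(r_t) b_t = 0 holds
   in M itself; hence <b_t> meets G_t trivially and G_(t+1) = G_t (+) <b_t>.
   The remaining relations give G_d = M. *)
Require Import Defs.
From mathcomp Require Import all_boot all_order all_algebra all_fingroup all_solvable.

Import Order.TTheory GRing.Theory Num.Theory.
Local Open Scope ring_scope.

Lemma group_mulrz {M : finZmodType} (G : {group M}) (x : M) (n : int) :
  x \in G -> x *~ n \in G.
Proof.
move=> Gx; case: n => n.
  by rewrite -pmulrn -FinRing.zmodXgE groupX.
by rewrite NegzE mulrNz -pmulrn -FinRing.zmodVgE -FinRing.zmodXgE groupVr ?groupX.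
Qed.

Lemma group_sumr {M : finZmodType} (G : {group M}) (n : nat) (F : 'I_n -> M) :
  (forall i, F i \in G) -> \sum_i F i \in G.
Proof.
move=> GF; elim/big_ind: _ => [|x y Gx Gy|i _]; [exact: group1 | | exact: GF].
by rewrite -FinRing.zmodMgE groupM.
Qed.

Lemma group_subr_mem {M : finZmodType} (G : {group M}) (x y : M) :
  y \in G -> (x - y \in G) = (x \in G).
Proof.
by move=> Gy; rewrite -FinRing.zmodVgE -FinRing.zmodMgE groupMr ?groupV.
Qed.

(** If [x ^+ k] lies in [G], so does [x ^+ gcdn (p ^ r) k], which is a power of it because
    [x ^+ (p ^ r)] is trivial. That gcd is some [p ^ m], so minimality gives [r <= m]; hence [p ^ r]
    divides [k] and [x ^+ k] is trivial. *)
Lemma setI_pcycle_trivial {gT : finGroupType} (G : {group gT}) (x : gT) (p r : nat) :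
    prime p -> (x ^+ (p ^ r))%g = 1%g ->
    (forall k, (x ^+ (p ^ k))%g \in G -> (r <= k)%N) ->
  (G :&: <[x]>)%g = 1%g.
Proof.
move=> p_pr xr rmin; apply/trivgP/subsetP => y /setIP[Gy /cycleP[k def_y]].
rewrite {y}def_y in Gy *.
have pr_gt0 : (0 < p ^ r)%N by rewrite expn_gt0 prime_gt0.
have [m _ def_m]: exists2 m, (m <= r)%N & gcdn (p ^ r) k = (p ^ m)%N.
  by apply/dvdn_pfactor => //; apply: dvdn_gcdl.
(* Bezout gives [p ^ r %| p ^ m + u * k], so [x ^+ (p ^ m)] is the inverse of [(x ^+ k) ^+ u]. *)
have [u _ /dvdnP[v def_v]] := Bezoutl k pr_gt0.
have x_m : (x ^+ (p ^ m) * (x ^+ k) ^+ u = 1)%g.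
  by rewrite -expgM -expgD -def_m (mulnC k) def_v mulnC expgM xr expg1n.
have /rmin le_rm : (x ^+ (p ^ m))%g \in G.
  by rewrite -(groupMr _ (groupX u Gy)) x_m group1.
have /dvdnP[w ->]: (p ^ r %| k)%N.
  by apply: dvdn_trans (dvdn_gcdr (p ^ r) k); rewrite def_m dvdn_exp2l.
by rewrite mulnC expgM xr expg1n inE.
Qed.

(** The group G_t of the chain, bundled as a group; its underlying set is the one in [r_mem] and
    [r_min]. *)
Definition prefix_group {M : finZmodType} (c : nat -> M) (t : nat) : {group M} :=
  <<[set c j | j : 'I_t]>>%G.

Lemma mem_prefix_group {M : finZmodType} (c : nat -> M) (t j : nat) :
  (j < t)%N -> c j \in prefix_group c t.
Proof. by move=> lt_jt; apply/mem_gen/imsetP; exists (Ordinal lt_jt). Qed.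

Lemma prefix_group_sum {M : finZmodType} (c : nat -> M) (t : nat) (z : nat -> int) :
  \sum_(j < t) c j *~ z j \in prefix_group c t.
Proof. by apply: group_sumr => j; apply/group_mulrz/mem_prefix_group/ltn_ord. Qed.

Lemma prefix_group_subP {M : finZmodType} (c : nat -> M) (t : nat) (H : {group M}) :
  (forall j, (j < t)%N -> c j \in H) -> prefix_group c t \subset H.
Proof.
by move=> Hc; rewrite gen_subG; apply/subsetP => _ /imsetP[j _ ->]; apply: Hc.
Qed.

(** One step of the unitriangular change of generators: [y] already lies in the smaller group, so
    adjoining [c t - y] has the same effect as adjoining [c t]. *)
Lemma prefix_groupS {M : finZmodType} (c : nat -> M) (t : nat) (y : M) :
    y \in prefix_group c t ->
  (prefix_group c t <*> <[c t - y]>)%g = prefix_group c t.+1.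
Proof.
move=> Gy; pose J := (prefix_group c t <*> <[c t - y]>)%G.
have sGS : prefix_group c t \subset prefix_group c t.+1.
  by apply: prefix_group_subP => j lt_jt; apply/mem_prefix_group/ltnW.
have sGJ : prefix_group c t \subset J by apply: joing_subl.
apply/eqP; rewrite eqEsubset join_subG sGS cycle_subG /=.
rewrite group_subr_mem ?(subsetP sGS y) ?mem_prefix_group //=.
apply: (prefix_group_subP _ _ J) => j; rewrite ltnS leq_eqVlt => /predU1P[->|lt_jt].
  rewrite -(group_subr_mem J (c t) _ (subsetP sGJ y Gy)).
  by rewrite -cycle_subG joing_subr.
by apply/(subsetP sGJ)/mem_prefix_group.
Qed.

Theorem theorem3p4 (p : nat) (M : finZmodType) (d q : nat)
    (c : nat -> M) (r : nat -> nat) (a : nat -> nat -> int) (b : nat -> M)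
    (p_prime : prime p)
    (M_pgroup : (p.-group [set: M])%g)
    (M_rank : ('m([set: M]))%g = d)
    (c_gen : (<<[set c i | i : 'I_q]>>)%g = [set: M])
    (c_ord : forall i j : nat, (i <= j < q)%N -> (#[c j]%g <= #[c i]%g)%N)
    (r_first : (p ^ r 0)%N = #[c 0%N]%g)
    (r_mem : forall t : nat, (0 < t < q)%N ->
       c t *+ (p ^ r t) \in (<<[set c j | j : 'I_t]>>)%g)
    (r_min : forall t k : nat, (0 < t < q)%N ->
       c t *+ (p ^ k) \in (<<[set c j | j : 'I_t]>>)%g -> (r t <= k)%N)
    (a_bound : forall t j : nat, (t < q)%N -> (j < t)%N -> (j < d)%N ->
       0 <= a t j <= (#[c j]%g)%:Z)
    (rel_first : c 0%N *+ (p ^ r 0%N) = 0)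
    (rel_basis : forall t : nat, (0 < t < d)%N ->
       c t *+ (p ^ r t) = (\sum_(j < t) c j *~ a t j) *+ (p ^ r t))
    (rel_rest : forall t : nat, (d <= t < q)%N ->
       c t = \sum_(j < d) c j *~ a t j)
    (b_first : b 0%N = c 0%N)
    (b_def : forall t : nat, (0 < t < d)%N ->
       b t = c t - \sum_(j < t) c j *~ a t j) :
  p_basis (fun i : 'I_d => b i).
Proof.
(* The rank is the least size of a generating set. This bound puts every [t < d] in the range
   [t < q] of [r_min]. *)
have le_dq : (d <= q)%N.
  rewrite -M_rank -c_gen; apply: leq_trans (grank_min _) _.
  by apply: leq_trans (leq_imset_card _ _) _; rewrite card_ord.
have genM : prefix_group c d = [set: M] :> {set M}.
  apply/eqP; rewrite eqEsubset subsetT -c_gen.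
  apply: (prefix_group_subP c q) => t lt_tq.
  (* Generators of index at least [d] are redundant by [rel_rest]. *)
  case: (ltnP t d) => [|le_dt]; first exact: mem_prefix_group.
  by rewrite rel_rest ?le_dt //; apply: prefix_group_sum.
rewrite /p_basis -genM.
(* Only the number of summands is generalized; the bound stays at [d], so the relations remain
   available at each stage. *)
elim: {-2}d (leqnn d) => [_|t IHt lt_td].
  by rewrite big_ord0; apply/esym/trivgP/prefix_group_subP.
rewrite big_ord_recr /= IHt 1?ltnW //.
have [s Gs def_bt] : exists2 s, s \in prefix_group c t & b t = c t - s.
  case: (posnP t) => [->|t_gt0]; first by exists 0; rewrite ?group1 // subr0.
  exists (\sum_(j < t) c j *~ a t j); last by rewrite b_def ?t_gt0.
  exact: prefix_group_sum.
have cGb : <[b t]>%G \subset ('C(prefix_group c t))%g.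
  exact: sub_abelian_cent2 (FinRing.zmod_abelian [set: M]) (subsetT _) (subsetT _).
rewrite dprodE //; first by rewrite -cent_joinEr // def_bt; apply: prefix_groupS.
(* The index 0 is outside the range of [r_min] and [rel_basis]; there the intersection is trivial
   because G_0 is. *)
case: (posnP t) => [->|t_gt0].
  have /trivgP -> : prefix_group c 0 \subset [1 M]%G by apply: prefix_group_subP.
  by apply/setIidPl/sub1G.
have t_basis : (0 < t < d)%N by rewrite t_gt0.
apply: (setI_pcycle_trivial _ _ p (r t)) => // [|k].
  by rewrite FinRing.zmodXgE b_def // mulrnBl rel_basis // subrr.
(* Since [s] is in G_t, the multiples of [b t] and [c t] by [p ^ k] lie in G_t together, so the
   minimality of [r t] passes from [c t] to [b t]. *)
rewrite FinRing.zmodXgE def_bt mulrnBl group_subr_mem.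
  by apply: r_min; rewrite t_gt0 (leq_trans lt_td).
by rewrite -FinRing.zmodXgE groupX.
Qed.
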